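(* Let $n$ be a fixed odd number. Then for any $f\in\mathcal{H}_n(\mathbb{B})$ and $x\in\mathbb{B}$, $$|f(x)|\le\left(\sum_{k=0}^\infty|x|^{2k}\right)^{\frac12}\|f\|_{\mathcal{H}_n(\mathbb{B})}=\sqrt{\frac{1}{1-|x|^2}}\,\|f\|_{\mathcal{H}_n(\mathbb{B})}.$$ Moreover, the reproducing kernel of the Clifford-Appell-Hardy space $\mathcal{H}_n(\mathbb{B})$ is given by the convergent series $$K_H(x,y)=\sum_{k=0}^\infty P_k^n(x)\overline{P_k^n(y)},\qquad x,y\in\mathbb{B}.$$
   Context: $\mathbb{R}_n$ is the real Clifford algebra generated by $e_1,\dots,e_n$ with $e_\ell e_m+e_me_\ell=0$ for $\ell\ne m$ and $e_\ell^2=-1$; for $a=\sum_A a_Ae_A$, $|a|=(\sum_A a_A^2)^{1/2}$; $a\mapsto\bar a$ is Clifford conjugation (the anti-automorphism with $\overline{e_\ell}=-e_\ell$) and $\mathrm{Re}(a)$ is the scalar part. A point $(x_0,\dots,x_n)\in\mathbb{R}^{n+1}$ is identified with the paravector $x=x_0+\underline{x}$, $\underline{x}=\sum_{\ell=1}^n x_\ell e_\ell$; $\bar x=x_0-\underline{x}$. $\mathbb{B}=\{x\in\mathbb{R}^{n+1}:|x|<1\}$. The Clifford-Appell polynomials are $$P_k^n(x):=\sum_{s=0}^k T_s^k(n)\,x^{k-s}\bar x^{s},\qquad T_s^k(n):=\binom{k}{s}\frac{\left(\frac{n+1}{2}\right)_{k-s}\left(\frac{n-1}{2}\right)_s}{(n)_k},$$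 where $(a)_0=1$ and $(a)_s=a(a+1)\cdots(a+s-1)$ for $s>0$. The Clifford-Appell-Hardy space is $\mathcal{H}_n(\mathbb{B}):=\{\sum_{k=0}^\infty P_k^n(x)\alpha_k:\alpha_k\in\mathbb{R}_n,\ \sum_k|\alpha_k|^2<\infty\}$, a module of functions on $\mathbb{B}$, with inner product $\langle\sum P_k^n\alpha_k,\sum P_k^n\beta_k\rangle_{\mathcal{H}_n(\mathbb{B})}=\sum_k\overline{\alpha_k}\beta_k$ and norm $\|f\|=\sqrt{\mathrm{Re}\langle f,f\rangle}$. Reproducing kernel means: $K_H(\cdot,y)\in\mathcal{H}_n(\mathbb{B})$ and $\langle K_H(\cdot,y),f\rangle_{\mathcal{H}_n(\mathbb{B})}=f(y)$ for all $f\in\mathcal{H}_n(\mathbb{B})$, $y\in\mathbb{B}$. *)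

(* Defs.v *)
From HB Require Import structures.
From mathcomp Require Import all_boot all_order all_algebra.
From mathcomp Require Import ring lra.
From mathcomp Require Import all_classical all_reals all_analysis.
(* Last, so that set0 is the empty {set T} rather than the empty classical set. *)
From mathcomp Require Import finset.

Set Implicit Arguments.
Unset Strict Implicit.
Unset Printing Implicit Defensive.

Import Order.TTheory GRing.Theory Num.Theory.
Import numFieldNormedType.Exports.

Local Open Scope ring_scope.

(* Symmetric difference; in the Clifford algebra e_A e_B = +- e_(A symd B). *)
Definition symd (T : finType) (A B : {set T}) : {set T} :=
  ((A :\: B) :|: (B :\: A))%SET.

Section SymDiff.
Variable T : finType.
Implicit Types A B C : {set T}.

Lemma in_symd A B x : (x \in symd A B) = (x \in A) (+) (x \in B).
Proof. by rewrite !inE; case: (x \in A); case: (x \in B). Qed.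

Lemma symdC A B : symd A B = symd B A.
Proof. by apply/setP => x; rewrite !in_symd addbC. Qed.

Lemma symdA A B C : symd A (symd B C) = symd (symd A B) C.
Proof. by apply/setP => x; rewrite !in_symd addbA. Qed.

Lemma symd0s A : symd set0 A = A.
Proof. by apply/setP => x; rewrite in_symd inE. Qed.

Lemma symdss A : symd A A = set0.
Proof. by apply/setP => x; rewrite in_symd addbb inE. Qed.

Lemma symdK A B : symd A (symd A B) = B.
Proof. by rewrite symdA symdss symd0s. Qed.

Lemma symdKr A B : symd (symd B A) A = B.
Proof. by rewrite -symdA symdss symdC symd0s. Qed.

Lemma symd_eq A B C : (symd A B == C) = (B == symd A C).
Proof. by apply/eqP/eqP => [<-|->]; rewrite symdK. Qed.

Lemma prod_symd (R : comNzRingType) (g : T -> R) A B :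
  (forall i, g i * g i = 1) ->
  \prod_(i in symd A B) g i = (\prod_(i in A) g i) * (\prod_(i in B) g i).
Proof.
move=> g2; rewrite big_mkcond [X in X * _]big_mkcond [X in _ * X]big_mkcond -big_split /=.
apply: eq_bigr => i _; rewrite in_symd; case: (i \in A); case: (i \in B) => //=;
  by rewrite ?g2 ?mulr1 ?mul1r.
Qed.

End SymDiff.

(* The real Clifford algebra R_n, as the coefficient families                 *)
(* a = \sum_A a_A e_A indexed by the subsets A of {1, ..., n}. This is an     *)
(* alias of the function type, so as to receive the Clifford product and the  *)
(* Euclidean norm rather than the pointwise product.                          *)
Definition clifford (R : realType) (n : nat) : Type := {ffun {set 'I_n} -> R}.

HB.instance Definition _ (R : realType) (n : nat) :=
  GRing.Lmodule.copy (clifford R n) {ffun {set 'I_n} -> R^o}.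

Section CliffordProduct.
Variables (R : realType) (n : nat).
Implicit Types (A B C : {set 'I_n}) (a b c : clifford R n).

(* For A = {i1 < ... < ip} and B = {j1 < ... < jq}, sorting the word          *)
(* e_i1 ... e_ip e_j1 ... e_jq costs one sign per pair (i, j) with j < i, and *)
(* each common index gives one more sign since e_i^2 = -1.                    *)
Definition clsign A B : R :=
  \prod_(i in A) \prod_(j in B | (j <= i)%N) (-1).

Definition clmul a b : clifford R n :=
  [ffun C : {set 'I_n} =>
    \sum_(A : {set 'I_n}) \sum_(B : {set 'I_n} | symd A B == C)
      clsign A B * (a A * b B)].

Definition blade A : clifford R n := [ffun B : {set 'I_n} => (B == A)%:R].

Let prodN1_sqr (I : finType) (P : pred I) :
  (\prod_(j in P) (-1 : R)) * \prod_(j in P) (-1) = 1.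
Proof. by rewrite -big_split /= mulrNN mulr1 big1. Qed.

Lemma clsign_symdl A B C : clsign (symd A B) C = clsign A C * clsign B C.
Proof. by apply: prod_symd => i; exact: prodN1_sqr. Qed.

Lemma clsign_symdr A B C : clsign A (symd B C) = clsign A B * clsign A C.
Proof.
rewrite /clsign -big_split /=; apply: eq_bigr => i _.
rewrite !big_mkcondr /=.
by apply: prod_symd => j; case: ifP; rewrite ?mulrNN ?mulr1.
Qed.

Lemma clsign0s A : clsign set0 A = 1.
Proof. by rewrite /clsign big_set0. Qed.

Lemma clsigns0 A : clsign A set0 = 1.
Proof.
by rewrite /clsign big1 // => i _; rewrite big_pred0 // => j; rewrite inE.
Qed.

Lemma clsign_sqr A B : clsign A B * clsign A B = 1.
Proof. by rewrite -clsign_symdl symdss clsign0s. Qed.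

Lemma clmulE a b C :
  clmul a b C = \sum_A clsign A (symd A C) * (a A * b (symd A C)).
Proof.
rewrite ffunE; apply: eq_bigr => A _.
by rewrite (big_pred1 (symd A C)) // => B; rewrite /= symd_eq.
Qed.

Lemma clscaleE (r : R) a A : (r *: a) A = r * a A.
Proof. by rewrite ffunE. Qed.

Let clmulA : associative clmul.
Proof.
move=> a b c; apply/ffunP => D; rewrite !clmulE.
under eq_bigr => A _ do rewrite clmulE !mulr_sumr.
under [RHS]eq_bigr => E _ do rewrite clmulE mulr_suml mulr_sumr.
rewrite [RHS]exchange_big /=; apply: eq_bigr => A _.
rewrite [RHS](reindex_onto (symd A) (symd A)) /=; last first.
  by move=> E _; rewrite symdK.
rewrite [RHS](eq_bigl xpredT) /=; last by move=> F; rewrite symdK eqxx.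
apply: eq_bigr => F _; rewrite symdK.
have -> : symd (symd A F) D = symd F (symd A D) by rewrite (symdC A) symdA.
set G := symd F (symd A D).
have -> : symd A D = symd F G by rewrite /G symdK.
rewrite clsign_symdl clsign_symdr; ring.
Qed.

Let clmul1r : left_id (blade set0) clmul.
Proof.
move=> a; apply/ffunP => C; rewrite clmulE (bigD1 set0) //= symd0s.
rewrite clsign0s mul1r ffunE eqxx mul1r big1 ?addr0 // => A A0.
by rewrite ffunE (negPf A0) mul0r mulr0.
Qed.

Let clmulr1 : right_id (blade set0) clmul.
Proof.
move=> a; apply/ffunP => C; rewrite clmulE (bigD1 C) //= symdss.
rewrite clsigns0 mul1r ffunE eqxx mulr1 big1 ?addr0 // => A AC.
by rewrite ffunE symd_eq [symd A set0]symdC symd0s eq_sym (negPf AC) !mulr0.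
Qed.

Let clmulDl : left_distributive clmul +%R.
Proof.
move=> a b c; apply/ffunP => C; rewrite [RHS]ffunE !clmulE -big_split /=.
by apply: eq_bigr => A _; rewrite ffunE mulrDl mulrDr.
Qed.

Let clmulDr : right_distributive clmul +%R.
Proof.
move=> a b c; apply/ffunP => C; rewrite [RHS]ffunE !clmulE -big_split /=.
by apply: eq_bigr => A _; rewrite ffunE mulrDr mulrDr.
Qed.

Let cl1_neq0 : blade set0 != 0 :> clifford R n.
Proof.
by apply/eqP => /ffunP/(_ set0)/eqP; rewrite !ffunE eqxx oner_eq0.
Qed.

HB.instance Definition _ := GRing.Zmodule_isNzRing.Build (clifford R n)
  clmulA clmul1r clmulr1 clmulDl clmulDr cl1_neq0.

Let clscaleAl (r : R) a b : r *: (a * b) = (r *: a) * b.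
Proof.
apply/ffunP => C; rewrite clscaleE [in LHS]clmulE [RHS]clmulE mulr_sumr.
by apply: eq_bigr => A _; rewrite clscaleE; ring.
Qed.

HB.instance Definition _ :=
  GRing.Lmodule_isLalgebra.Build R (clifford R n) clscaleAl.

Let clscaleAr (r : R) a b : r *: (a * b) = a * (r *: b).
Proof.
apply/ffunP => C; rewrite clscaleE [in LHS]clmulE [RHS]clmulE mulr_sumr.
by apply: eq_bigr => A _; rewrite clscaleE; ring.
Qed.

HB.instance Definition _ :=
  GRing.Lalgebra_isAlgebra.Build R (clifford R n) clscaleAr.

Definition clgen (l : 'I_n) : clifford R n := blade [set l].

Lemma blade_mul A B : blade A * blade B = clsign A B *: blade (symd A B).
Proof.
apply/ffunP => C; rewrite [LHS]clmulE clscaleE (bigD1 A) //= big1 ?addr0.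
  by rewrite !ffunE eqxx mul1r symd_eq; case: eqP => [->|]; rewrite ?symdK // !mulr0.
by move=> D DA; rewrite !ffunE (negPf DA) mul0r mulr0.
Qed.

Lemma clgen_sqr l : clgen l * clgen l = -1.
Proof.
rewrite blade_mul symdss /clsign big_set1 (big_pred1 l) ?scaleN1r // => j.
by rewrite /= inE; case: eqP => [->|//]; rewrite leqnn.
Qed.

Lemma clgen_anti l m : l != m -> clgen l * clgen m + clgen m * clgen l = 0.
Proof.
move=> lm; rewrite !blade_mul (symdC [set m]) -scalerDl.
suff -> : clsign [set l] [set m] + clsign [set m] [set l] = 0.
  by rewrite scale0r.
rewrite /clsign !big_set1; wlog ltlm : l m lm / (l < m)%N.
  move=> th; case: (ltngtP l m) => [/th->//|/th th'|/val_inj/eqP].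
    by rewrite addrC th' // eq_sym.
  by rewrite (negPf lm).
rewrite big_pred0 => [|j]; last first.
  by rewrite inE; case: eqP => // ->; rewrite leqNgt ltlm.
rewrite (big_pred1 l) ?subrr // => j /=.
by rewrite inE; case: eqP => // ->; rewrite ltnW.
Qed.

Lemma clgen_blade (l : 'I_n) A : (forall j, j \in A -> (l < j)%N) ->
  clgen l * blade A = blade (l |: A)%SET.
Proof.
move=> lA; rewrite blade_mul /clsign big_set1 big_pred0 => [|j].
  rewrite scale1r; congr blade; apply/setP => j; rewrite in_symd !inE.
  by case: eqP => // ->; case: (boolP (l \in A)) => // /lA; rewrite ltnn.
by apply/negP => /andP[/lA]; rewrite ltnNge => /negP.
Qed.

(* The anti-automorphism with e_l |-> - e_l: reversing a product of p distinct *)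
(* generators gives the sign (-1)^(p(p-1)/2), whence (-1)^(p(p+1)/2) in all;   *)
(* see clconj_gen and clconjM.                                                 *)
Definition clconj a : clifford R n :=
  [ffun A : {set 'I_n} => (-1) ^+ 'C(#|A|.+1, 2) * a A].

Let clsign_cross l A : l \notin A ->
  clsign [set l] A * clsign A [set l] = (-1) ^+ #|A|.
Proof.
move=> lA; rewrite /clsign big_set1 big_mkcondr -big_split /= -prodr_const.
apply: eq_bigr => i iA; have il : i != l by apply: contraNneq lA => <-.
case: (ltngtP i l) => [ltil|ltli|/val_inj/eqP]; last by rewrite (negPf il).
  rewrite big_pred0 ?mulr1 // => j.
  by rewrite inE; case: eqP => // ->; rewrite leqNgt ltil.
rewrite (big_pred1 l) ?mul1r // => j /=.
by rewrite inE; case: eqP => // ->; rewrite ltnW.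
Qed.

Lemma clsign_diag A : clsign A A = (-1) ^+ 'C(#|A|.+1, 2).
Proof.
elim: {A}#|A| {-2}A (erefl #|A|) => [|p IHp] A cA.
  by move/cards0_eq: cA => ->; rewrite clsign0s cards0.
have [l lA] : exists l, l \in A by apply/card_gt0P; rewrite cA.
pose B := (A :\ l)%SET; have lB : l \notin B by rewrite !inE eqxx.
have cB : #|B| = p by apply/eqP; rewrite -eqSS -cA (cardsD1 l A) lA.
have eA : A = symd [set l] B.
  apply/setP => i; rewrite in_symd !inE.
  by case: eqP => [->|]; rewrite ?lA //; case: (i \in A).
have ll : clsign [set l] [set l] = -1.
  rewrite /clsign big_set1 (big_pred1 l) // => j.
  by rewrite /= inE; case: eqP => [->|//]; rewrite leqnn.
rewrite [in LHS]eA clsign_symdl !clsign_symdr cA ll mulrA -(mulrA (-1)).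
rewrite clsign_cross // IHp // cB [in RHS]binS bin1 exprD exprS; ring.
Qed.

Lemma clconj_gen l : clconj (clgen l) = - clgen l.
Proof.
apply/ffunP => A; rewrite !ffunE; case: eqP => [->|]; last by rewrite mulr0 oppr0.
by rewrite cards1 expr1 mulr1.
Qed.

Lemma clconjD a b : clconj (a + b) = clconj a + clconj b.
Proof. by apply/ffunP => A; rewrite !ffunE mulrDr. Qed.

Lemma clconjZ r a : clconj (r *: a) = r *: clconj a.
Proof. by apply/ffunP => A; rewrite ffunE !clscaleE ffunE mulrCA. Qed.

Lemma clconjM a b : clconj (a * b) = clconj b * clconj a.
Proof.
apply/ffunP => C; rewrite [LHS]ffunE [in LHS]clmulE [RHS]clmulE mulr_sumr.
rewrite [RHS](reindex_onto (fun A => symd A C) (fun A => symd A C)) /=;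
  last by move=> A _; rewrite symdKr.
rewrite [RHS](eq_bigl xpredT) /=; last by move=> A; rewrite symdKr eqxx.
apply: eq_bigr => A _; rewrite symdKr; set B := symd A C.
have -> : C = symd A B by rewrite symdK.
rewrite !ffunE -!clsign_diag; clearbody B.
rewrite clsign_symdl !clsign_symdr.
transitivity (clsign A B * clsign A B * (clsign A A * clsign B A *
  clsign B B * a A * b B)); first by ring.
by rewrite clsign_sqr; ring.
Qed.

Definition clre a : R := a set0.

Definition clnorm a : R := Num.sqrt (\sum_(A : {set 'I_n}) a A ^+ 2).

Let sumsq_ge0 a : 0 <= \sum_(A : {set 'I_n}) a A ^+ 2.
Proof. by apply: sumr_ge0 => A _; exact: sqr_ge0. Qed.

Lemma clnorm_sqr a : clnorm a ^+ 2 = \sum_(A : {set 'I_n}) a A ^+ 2.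
Proof. by rewrite sqr_sqrtr. Qed.

Let cauchy_schwarz a b :
  (\sum_(A : {set 'I_n}) a A * b A) ^+ 2 <= clnorm a ^+ 2 * clnorm b ^+ 2.
Proof.
rewrite !clnorm_sqr.
have : 0 <= \sum_(A : {set 'I_n}) \sum_(B : {set 'I_n})
    (a A * b B - a B * b A) ^+ 2.
  by apply: sumr_ge0 => A _; apply: sumr_ge0 => B _; exact: sqr_ge0.
have E A : \sum_(B : {set 'I_n}) (a A * b B - a B * b A) ^+ 2 =
    a A ^+ 2 * (\sum_B b B ^+ 2) + b A ^+ 2 * (\sum_B a B ^+ 2)
      - 2 * (a A * b A) * (\sum_B a B * b B).
  rewrite !mulr_sumr -big_split -sumrB /=; apply: eq_bigr => B _; ring.
under eq_bigr do rewrite E.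
rewrite sumrB big_split /= -!mulr_suml -mulr_sumr; nra.
Qed.

Let clnorm_ge0 a : 0 <= clnorm a.
Proof. exact: sqrtr_ge0. Qed.

Let ler_clnormD a b : clnorm (a + b) <= clnorm a + clnorm b.
Proof.
rewrite -ler_sqr ?nnegrE ?addr_ge0 // sqrrD clnorm_sqr.
under eq_bigr do rewrite ffunE sqrrD.
rewrite !big_split /= -!clnorm_sqr lerD2r lerD2l -mulr2n.
rewrite lerMn2r /= (le_trans (ler_norm _)) //.
by rewrite -ler_sqr ?nnegrE ?mulr_ge0 // exprMn real_normK ?num_real.
Qed.

Let clnormZ (r : R) a : clnorm (r *: a) = `|r| * clnorm a.
Proof.
rewrite /clnorm; under eq_bigr do rewrite clscaleE exprMn.
by rewrite -mulr_sumr sqrtrM ?sqr_ge0 // sqrtr_sqr.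
Qed.

Let clnorm0_eq0 a : clnorm a = 0 -> a = 0.
Proof.
move=> a0; have /eqP : \sum_(A : {set 'I_n}) a A ^+ 2 = 0.
  by rewrite -clnorm_sqr a0 expr0n.
rewrite psumr_eq0 => [/allP aE|A _]; last exact: sqr_ge0.
apply/ffunP => A; rewrite ffunE; apply/eqP.
by rewrite -sqrf_eq0; apply: aE; rewrite mem_index_enum.
Qed.

HB.instance Definition _ := Lmodule_isNormed.Build R (clifford R n)
  ler_clnormD clnormZ clnorm0_eq0.

Lemma clnormE a : `|a| = Num.sqrt (\sum_(A : {set 'I_n}) a A ^+ 2).
Proof. by []. Qed.

End CliffordProduct.

Local Open Scope classical_set_scope.

Section CliffordAppell.
Variables (R : realType) (n : nat).

(* Points of R^(n+1) are row vectors, entered into the algebra as paravectors. *)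
(* The library norm on row vectors is the sup norm, so |x| is always written   *)
(* `|para x|, which is the Euclidean norm of x.                                *)
Definition para (x : 'rV[R]_n.+1) : clifford R n :=
  x ord0 ord0 *: 1 + \sum_(l < n) x ord0 (lift ord0 l) *: clgen R l.

Definition unit_ball : set 'rV[R]_n.+1 := [set x | `|para x| < 1].

Definition pochhammer (a : R) (s : nat) : R := \prod_(i < s) (a + i%:R).

Definition appell_coef (k s : nat) : R :=
  'C(k, s)%:R * (pochhammer ((n%:R + 1) / 2) (k - s) *
                 pochhammer ((n%:R - 1) / 2) s / pochhammer n%:R k).

Definition appell (k : nat) (x : 'rV[R]_n.+1) : clifford R n :=
  \sum_(s < k.+1)
    appell_coef k s *: (para x ^+ (k - s) * clconj (para x) ^+ s).

(* alpha is a square-summable coefficient sequence of f on the unit ball.     *)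
(* Functions on the ball are total functions whose values outside the ball    *)
(* are irrelevant.                                                            *)
Definition appell_expansion (f : 'rV[R]_n.+1 -> clifford R n)
    (alpha : nat -> clifford R n) : Prop :=
  cvgn (series (fun k => `|alpha k| ^+ 2)) /\
  forall x, unit_ball x -> series (fun k => appell k x * alpha k) @ \oo --> f x.

Definition hardy : set ('rV[R]_n.+1 -> clifford R n) :=
  [set f | exists alpha, appell_expansion f alpha].

(* The coefficients of f \in hardy; they are unique for n > 0, since P_k maps *)
(* a real number t to t^k.                                                     *)
Definition hardy_coef (f : 'rV[R]_n.+1 -> clifford R n) : nat -> clifford R n :=
  xget (fun=> 0) [set alpha | appell_expansion f alpha].

Definition hardy_inner (f g : 'rV[R]_n.+1 -> clifford R n) : clifford R n :=
  limn (series (fun k => clconj (hardy_coef f k) * hardy_coef g k)).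

Definition hardy_norm (f : 'rV[R]_n.+1 -> clifford R n) : R :=
  Num.sqrt (clre (hardy_inner f f)).

Definition reproducing_kernel
    (K : 'rV[R]_n.+1 -> 'rV[R]_n.+1 -> clifford R n) : Prop :=
  forall y, unit_ball y ->
    hardy (K ^~ y) /\ forall f, hardy f -> hardy_inner (K ^~ y) f = f y.

End CliffordAppell.

(* Main.v *)
(* For n > 0 the coefficients T_s^k(n) are nonnegative and, by the
   Chu-Vandermonde identity, sum to 1.  A paravector satisfies |x a| = |x| |a|,
   so |P_k(x) a| <= |x|^k |a|: with Cauchy-Schwarz this gives the pointwise
   estimate, and it makes the kernel series converge absolutely.  On the real
   axis P_k(t) = t^k, so the coefficients of a function are unique as those of
   a power series; K_H(., y) then has coefficients conj(P_k(y)), and its inner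
   product with f is the expansion of f at y. *)
Require Import Defs.
From HB Require Import structures.
From mathcomp Require Import all_boot all_order all_algebra.
From mathcomp Require Import ring lra.
From mathcomp Require Import all_classical all_reals all_analysis.
Set Implicit Arguments.
Unset Strict Implicit.
Unset Printing Implicit Defensive.

Import Order.TTheory GRing.Theory Num.Theory.
Import numFieldNormedType.Exports.
Local Open Scope classical_set_scope.
Local Open Scope ring_scope.

(** * Pochhammer symbols and the Chu-Vandermonde identity *)

Section Pochhammer.
Variable R : realType.
Implicit Types (a b : R) (k s : nat).

Lemma pochhammerS a s : pochhammer a s.+1 = pochhammer a s * (a + s%:R).
Proof. by rewrite /pochhammer big_ord_recr. Qed.

Lemma pochhammer_ge0 a s : 0 <= a -> 0 <= pochhammer a s.
Proof. by move=> a0; apply: prodr_ge0 => i _; rewrite addr_ge0. Qed.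

Lemma pochhammer_gt0 a s : 0 < a -> 0 < pochhammer a s.
Proof. by move=> a0; apply: prodr_gt0 => i _; rewrite ltr_wpDr. Qed.

Lemma pochhammer_Vandermonde a b k :
  \sum_(s < k.+1) 'C(k, s)%:R * (pochhammer a (k - s) * pochhammer b s) =
  pochhammer (a + b) k.
Proof.
elim: k => [|k IHk].
  by rewrite big_ord_recl big_ord0 /pochhammer !big_ord0 bin0 !mulr1 addr0.
pose t s := pochhammer a (k.+1 - s) * pochhammer b s.
(* The new factor a + b + k splits as (a + (k - s)) + (b + s), and each summand extends one of the
   two Pochhammer symbols. *)
have -> : pochhammer (a + b) k.+1 = \sum_(s < k.+1) 'C(k, s)%:R * (t s + t s.+1).
  rewrite pochhammerS -IHk mulr_suml; apply: eq_bigr => s _.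
  have sk : (s <= k)%N by rewrite -ltnS.
  rewrite /t subSS subSn // !pochhammerS natrB //; ring.
(* Appending the zero term 'C(k, k + 1) shifts the index, which prepares Pascal's rule. *)
have t0 : \sum_(s < k.+1) 'C(k, s)%:R * t s =
    t 0%N + \sum_(s < k.+1) 'C(k, s.+1)%:R * t s.+1.
  transitivity (\sum_(s < k.+2) 'C(k, s)%:R * t s).
    by rewrite [RHS]big_ord_recr /= bin_small // mul0r addr0.
  by rewrite big_ord_recl bin0 mul1r.
rewrite big_ord_recl bin0 mul1r -/(t 0%N).
under [RHS]eq_bigr do rewrite mulrDr.
rewrite big_split /= t0 -addrA -big_split /=; congr (_ + _).
by apply: eq_bigr => s _; rewrite binS natrD mulrDl.
Qed.

End Pochhammer.

(** * Euclidean norm, conjugation and products in the Clifford algebra *)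

Section CliffordNorm.
Variables (R : realType) (n : nat).
Implicit Types (a b : clifford R n).

Lemma sqr_normE a : `|a| ^+ 2 = \sum_A a A ^+ 2.
Proof. exact: clnorm_sqr. Qed.

Lemma ler_coord_norm a A : `|a A| <= `|a|.
Proof.
rewrite -ler_sqr ?nnegrE // sqr_normE real_normK ?num_real //.
by rewrite (bigD1 A) //= lerDl sumr_ge0 // => B _; exact: sqr_ge0.
Qed.

Lemma clconj_norm a : `|clconj a| = `|a|.
Proof.
rewrite !clnormE; congr Num.sqrt; apply: eq_bigr => A _.
by rewrite ffunE exprMn -exprM mulnC exprM sqrrN !expr1n mul1r.
Qed.

Lemma clconjK : involutive (@clconj R n).
Proof.
move=> a; apply/ffunP => A.
by rewrite !ffunE mulrA -expr2 -exprM mulnC exprM sqrrN !expr1n mul1r.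
Qed.

Lemma clconj1 : clconj 1 = 1 :> clifford R n.
Proof.
apply/ffunP => A; rewrite !ffunE; case: eqP => [->|]; last by rewrite mulr0.
by rewrite cards0 bin_small ?mulr1.
Qed.

Lemma clconj0 : clconj 0 = 0 :> clifford R n.
Proof. by apply/ffunP => A; rewrite !ffunE mulr0. Qed.

Lemma clconj_sum (I : Type) (r : seq I) (P : pred I) (F : I -> clifford R n) :
  clconj (\sum_(i <- r | P i) F i) = \sum_(i <- r | P i) clconj (F i).
Proof. exact: (big_morph _ (@clconjD R n) clconj0). Qed.

(** The conjugation sign of [blade A] is [clsign A A], the sign of its square, so the two signs
    cancel in every scalar term. *)
Lemma clre_conjM a : clre (clconj a * a) = `|a| ^+ 2.
Proof.
rewrite sqr_normE /clre [LHS]clmulE; apply: eq_bigr => A _.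
rewrite symdC symd0s ffunE clsign_diag !mulrA -expr2.
by rewrite -exprM mulnC exprM sqrrN !expr1n mul1r expr2.
Qed.

(** A crude bound with one term per blade, valid for arbitrary Clifford factors; it serves the
    convergence of the inner product series. *)
Lemma ler_coord_mul a b C : `|(a * b) C| <= #|{set 'I_n}|%:R * (`|a| * `|b|).
Proof.
rewrite [in X in X <= _]clmulE (le_trans (ler_norm_sum _ _ _)) //.
rewrite mulr_natl -sumr_const; apply: ler_sum => A _.
rewrite !normrM; have -> : `|clsign R A (symd A C)| = 1.
  apply/eqP; rewrite -sqrp_eq1 // real_normK ?num_real //.
  by rewrite expr2 clsign_sqr.
by rewrite mul1r ler_pM // ler_coord_norm.
Qed.

Lemma clreZ (c : R) a : clre (c *: a) = c * clre a.
Proof. exact: clscaleE. Qed.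

(** |ab|^2 is the scalar part of conj(b) conj(a) a b, in which the real factor conj(a) a = |a|^2 can
    be pulled out. *)
Lemma norm_mul_clconj_scalar (c : R) a b :
  clconj a * a = c *: 1 -> `|a * b| = `|a| * `|b|.
Proof.
move=> ac.
have c2 : c = `|a| ^+ 2.
  by rewrite -clre_conjM ac /clre clscaleE ffunE eqxx mulr1.
apply/eqP; rewrite -(eqrXn2 (n := 2)) ?mulr_ge0 // exprMn; apply/eqP.
rewrite -clre_conjM.
rewrite clconjM -mulrA (mulrA _ a) ac -scalerAl mul1r -scalerAr.
by rewrite clreZ clre_conjM c2.
Qed.

End CliffordNorm.

(** * Paravectors and bounds for the Appell polynomials *)

Section Paravector.
Variables (R : realType) (n : nat).
Implicit Types (x : 'rV[R]_n.+1) (a : clifford R n).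

Lemma clvec_sqr (v : 'I_n -> R) :
  exists c : R, (\sum_l v l *: clgen R l) * (\sum_l v l *: clgen R l) = c *: 1.
Proof.
exists (- \sum_l v l ^+ 2).
(* Doubling the double sum pairs e_l e_m with e_m e_l, so that the off-diagonal terms cancel by
   anticommutation. *)
have inj2 (a b : clifford R n) : a + a = b + b -> a = b.
  move=> /ffunP ab; apply/ffunP => A; have := ab A.
  by rewrite !ffunE; lra.
apply: inj2; rewrite big_distrlr /= [X in _ + X]exchange_big -big_split /=.
rewrite -scalerDl -opprD -big_split /= scaleNr scaler_suml -sumrN.
apply: eq_bigr => l _; rewrite -big_split /= (bigD1 l) //= big1 ?addr0.
  by rewrite -scalerAl -scalerAr clgen_sqr scalerA -expr2 !scalerN scalerDl opprD.
move=> m ml; rewrite -!scalerAl -!scalerAr !scalerA (mulrC (v m)) -scalerDr.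
by rewrite clgen_anti ?scaler0 // eq_sym.
Qed.

Lemma clconj_para x : clconj (para x) =
  x ord0 ord0 *: 1 - \sum_(l < n) x ord0 (lift ord0 l) *: clgen R l.
Proof.
rewrite clconjD clconjZ clconj1 clconj_sum -sumrN; congr (_ + _).
by apply: eq_bigr => l _; rewrite clconjZ clconj_gen scalerN.
Qed.

(** The real part t commutes with the vector part v, so both products are t^2 - v^2, and v^2 is
    real. *)
Lemma para_conj_scalar x : exists c : R,
  clconj (para x) * para x = c *: 1 /\ para x * clconj (para x) = c *: 1.
Proof.
rewrite clconj_para /para; have [c] := clvec_sqr (fun l => x ord0 (lift ord0 l)).
set v := \sum_l _ => vv; set t := x ord0 ord0; exists (t ^+ 2 - c).
have tv : (t *: 1) * v = t *: v by rewrite -scalerAl mul1r.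
have vt : v * (t *: 1) = t *: v by rewrite -scalerAr mulr1.
have e : (t *: 1) * (t *: 1) - v * v = (t ^+ 2 - c) *: 1.
  by rewrite vv -scalerAl mul1r scalerA scalerBl.
rewrite -e; split.
  by rewrite mulrBl !mulrDr tv vt opprD addrA addrK.
by rewrite mulrDl !mulrBr tv vt addrA subrK.
Qed.

Lemma norm_para_mul x a : `|para x * a| = `|para x| * `|a|.
Proof.
by have [c [xx _]] := para_conj_scalar x; exact: norm_mul_clconj_scalar xx.
Qed.

Lemma norm_clconj_para_mul x a : `|clconj (para x) * a| = `|para x| * `|a|.
Proof.
have [c [_ xx]] := para_conj_scalar x.
by rewrite (@norm_mul_clconj_scalar _ _ c) ?clconjK // clconj_norm.
Qed.

Lemma norm_para_expM x k s a :
  `|para x ^+ k * clconj (para x) ^+ s * a| = `|para x| ^+ (k + s) * `|a|.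
Proof.
elim: k => [|k IHk]; last by rewrite !exprS -!mulrA norm_para_mul mulrA IHk mulrA.
rewrite mul1r add0n; elim: s => [|s IHs]; first by rewrite !mul1r.
by rewrite !exprS -mulrA norm_clconj_para_mul IHs mulrA.
Qed.

(** For n >= 1 the parameter (n - 1)/2 is nonnegative, and so is every factor. *)
Lemma appell_coef_ge0 k s : (0 < n)%N -> 0 <= appell_coef R n k s.
Proof.
move=> n0; have n1 : 1 <= n%:R :> R by rewrite ler1n.
rewrite /appell_coef mulr_ge0 // divr_ge0 ?mulr_ge0 ?pochhammer_ge0 //; lra.
Qed.

(** The parameters (n + 1)/2 and (n - 1)/2 add up to n, so Chu-Vandermonde yields exactly the
    denominator. *)
Lemma sum_appell_coef k : (0 < n)%N -> \sum_(s < k.+1) appell_coef R n k s = 1.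
Proof.
move=> n0; rewrite /appell_coef; under eq_bigr do rewrite !mulrA -(mulrA _%:R).
rewrite -mulr_suml pochhammer_Vandermonde.
have -> : (n%:R + 1) / 2 + (n%:R - 1) / 2 = n%:R :> R by field.
by rewrite divff // gt_eqF // pochhammer_gt0 // ltr0n.
Qed.

(** P_k(x) a is a convex combination of products each of norm exactly |x|^k |a|. *)
Lemma norm_appellM k x a : (0 < n)%N -> `|appell k x * a| <= `|para x| ^+ k * `|a|.
Proof.
move=> n0; rewrite /appell mulr_suml (le_trans (ler_norm_sum _ _ _)) //.
rewrite -[leRHS]mul1r -(sum_appell_coef k n0) mulr_suml ler_sum // => s _.
rewrite -scalerAl normrZ ger0_norm ?appell_coef_ge0 // norm_para_expM.
by rewrite subnK // -ltnS.
Qed.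

Lemma norm_appell k x : (0 < n)%N -> `|appell k x| <= `|para x| ^+ k.
Proof.
move=> n0; have n1 : `|1 : clifford R n| = 1.
  rewrite -[RHS]sqrtr1 clnormE; congr Num.sqrt.
  rewrite (bigD1 finset.set0) //= ffunE eqxx expr1n big1 ?addr0 // => A A0.
  by rewrite ffunE (negPf A0) expr0n.
by have := norm_appellM k x 1 n0; rewrite n1 !mulr1.
Qed.

(** Restriction to these points turns an Appell series into a power series in [t]. *)
Definition real_point (t : R) : 'rV[R]_n.+1 := t *: delta_mx 0 0.

Lemma para_real_point t : para (real_point t) = t *: 1.
Proof.
rewrite /para !mxE eqxx mulr1 big1 ?addr0 // => l _.
by rewrite !mxE andbF mulr0 scale0r.
Qed.

Lemma norm_real_point t : `|para (real_point t)| = `|t|.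
Proof.
rewrite para_real_point clnormE (bigD1 finset.set0) //= big1 => [|A A0].
  by rewrite clscaleE ffunE eqxx mulr1 addr0 sqrtr_sqr.
by rewrite clscaleE ffunE (negPf A0) mulr0 expr0n.
Qed.

Lemma appell_real_point k t : (0 < n)%N -> appell k (real_point t) = t ^+ k *: 1.
Proof.
move=> n0; rewrite -[RHS]scale1r -(sum_appell_coef k n0) scaler_suml /appell.
apply: eq_bigr => s _; congr (_ *: _).
rewrite para_real_point clconjZ clconj1 !exprZn !expr1n -scalerAl mul1r.
by rewrite scalerA -exprD subnK // -ltnS.
Qed.

End Paravector.

(** * Inequalities for real sums and series *)

Lemma sum_CauchySchwarz (R : realType) (a b : nat -> R) N :
  (\sum_(0 <= k < N) a k * b k) ^+ 2 <=
  (\sum_(0 <= k < N) a k ^+ 2) * (\sum_(0 <= k < N) b k ^+ 2).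
Proof.
elim: N => [|N IHN]; first by rewrite !big_geq // mulr0 expr0n.
rewrite !big_nat_recr //=.
set S := \sum_(0 <= k < N) a k * b k in IHN *.
set A := \sum_(0 <= k < N) a k ^+ 2 in IHN *.
set B := \sum_(0 <= k < N) b k ^+ 2 in IHN *.
have A0 : 0 <= A by apply: sumr_ge0 => k _; exact: sqr_ge0.
have B0 : 0 <= B by apply: sumr_ge0 => k _; exact: sqr_ge0.
(* Only the cross term remains. Since S^2 <= A B, its square is at most 4 (A b_N^2) (B a_N^2), hence
   at most the square of the right-hand side. *)
suff : 2 * S * (a N * b N) <= A * b N ^+ 2 + B * a N ^+ 2 by nra.
have AB0 : 0 <= A * b N ^+ 2 + B * a N ^+ 2.
  by rewrite addr_ge0 // mulr_ge0 // sqr_ge0.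
rewrite (le_trans (ler_norm _)) // -ler_sqr ?nnegrE // real_normK ?num_real //.
have := ler_wpM2r (sqr_ge0 (a N * b N)) IHN.
have := sqr_ge0 (A * b N ^+ 2 - B * a N ^+ 2); lra.
Qed.

Lemma term_le_series_lim (R : realType) (u : nat -> R) k :
  (forall k, 0 <= u k) -> cvgn (series u) -> u k <= limn (series u).
Proof.
move=> u0 cu; have nd : nondecreasing_seq (series u).
  by apply: nondecreasing_series => i _ _; exact: u0.
apply: le_trans (nondecreasing_cvgn_le nd cu k.+1).
rewrite seriesEnat /= big_nat_recr //= lerDr.
by apply: sumr_ge0 => i _; exact: u0.
Qed.

(** * Vanishing of the coefficients of a null power series *)

Section PowerSeries.
Variables (R : realType) (V : normedModType R).

(* Once the coefficients below m vanish, |c_m| <= 2 M t for all small t > 0. *)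
Lemma power_series_eq0 (c : nat -> V) (M : R) : (forall k, `|c k| <= M) ->
  (forall t : R, 0 < t < 1 -> series (fun k => t ^+ k *: c k) @ \oo --> (0 : V)) ->
  forall k, c k = 0.
Proof.
move=> cM c0; elim/ltn_ind => m IHm.
have M0 : 0 <= M by rewrite (le_trans _ (cM 0%N)).
have small t : 0 < t -> t <= 2^-1 -> `|c m| <= 2 * M * t.
  move=> t0 t2; pose S := series (fun k => t ^+ k *: c k).
  (* As t <= 1/2, the terms after the m-th are at most M t^(m+1) 2^-i, and 2 (1 - 2^-N) is the sum
     of 2^-i for i < N. *)
  have bound N : `|t ^+ m *: c m - S (N + m.+1)%N| <=
      2 * M * t ^+ m.+1 * (1 - 2^-1 ^+ N).
    elim: N => [|N IHN].
      rewrite expr0 subrr mulr0 /S /series /= add0n big_nat_recr //=.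
      rewrite big_nat big1 ?add0r ?subrr ?normr0 // => i /andP[_ im].
      by rewrite IHm // scaler0.
    have -> : S (N.+1 + m.+1)%N =
        S (N + m.+1)%N + t ^+ (N + m.+1) *: c (N + m.+1)%N.
      by rewrite /S /series /= addSn big_nat_recr.
    rewrite opprD addrA (le_trans (ler_normB _ _)) //.
    have tN : `|t ^+ (N + m.+1) *: c (N + m.+1)%N| <= M * t ^+ m.+1 * 2^-1 ^+ N.
      rewrite normrZ ger0_norm ?exprn_ge0 ?(ltW t0) // exprD.
      rewrite [leLHS]mulrC (mulrC (t ^+ N)) mulrA ler_pM ?mulr_ge0 ?exprn_ge0 ?(ltW t0) //.
        by rewrite ler_pM ?exprn_ge0 ?(ltW t0).
      by rewrite lerXn2r ?nnegrE ?(ltW t0) ?invr_ge0.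
    apply: le_trans (lerD IHN tN) _; rewrite [2^-1 ^+ N.+1]exprS; lra.
  have cvgS : (fun N => `|t ^+ m *: c m - S (N + m.+1)%N|) @ \oo --> `|t ^+ m *: c m|.
    rewrite -[in X in _ --> X](subr0 (t ^+ m *: c m)); apply: cvg_norm; apply: cvgB; first exact: cvg_cst.
    by rewrite (cvg_shiftn m.+1 S); apply: c0; rewrite t0 /=; lra.
  have : `|t ^+ m *: c m| <= 2 * M * t ^+ m.+1.
    rewrite -(cvg_lim _ cvgS) //; apply: limr_le; first exact: cvgP cvgS.
    apply: nearW => N; rewrite (le_trans (bound N)) // ler_piMr ?mulr_ge0 ?exprn_ge0 ?(ltW t0) //.
  rewrite normrZ ger0_norm ?exprn_ge0 ?(ltW t0) // exprSr mulrA mulrAC mulrC.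
  by rewrite ler_pM2r // exprn_gt0.
apply/eqP; rewrite -normr_le0 leNgt; apply/negP => g0.
have gM : 0 < M + `|c m| by lra.
(* This value of t would give |c_m| < |c_m| / 2; the summand |c_m| in the denominator keeps it
   positive even when M = 0. *)
have t2 : `|c m| / (4 * (M + `|c m|)) <= 2^-1.
  by rewrite ler_pdivrMr ?mulr_gt0 //; lra.
have t0 : 0 < `|c m| / (4 * (M + `|c m|)) by rewrite divr_gt0 // mulr_gt0.
have := small _ t0 t2; rewrite mulrA ler_pdivlMr ?mulr_gt0 //; nra.
Qed.

End PowerSeries.

(** * Limits and series in the Clifford algebra, by coordinates *)

Section CliffordLimits.
Variables (R : realType) (n : nat).
Implicit Types (u : nat -> clifford R n) (l a : clifford R n).

Lemma cvg_coord u l A : u @ \oo --> l -> (fun k => u k A) @ \oo --> l A.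
Proof.
move=> /cvgrPdist_lt ul; apply/cvgrPdist_lt => e e0.
apply: filterS (ul e e0) => k; apply: le_lt_trans.
by have := ler_coord_norm (l - u k) A; rewrite !ffunE.
Qed.

Lemma clifford_bladeE a : a = \sum_A a A *: blade R A.
Proof.
apply/ffunP => B; rewrite sum_ffunE (bigD1 B) //= big1 => [|A AB].
  by rewrite clscaleE ffunE eqxx mulr1 addr0.
by rewrite clscaleE ffunE eq_sym (negPf AB) mulr0.
Qed.

Lemma cvg_clifford u l :
  (forall A, (fun k => u k A) @ \oo --> l A) -> u @ \oo --> l.
Proof.
move=> ul; rewrite [l]clifford_bladeE (_ : u = fun k => \sum_A u k A *: blade R A).
  by apply: cvg_big => [|A _]; [exact: add_continuous | apply: cvgZr_tmp; exact: ul].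
by apply/funext => k; exact: clifford_bladeE.
Qed.

Lemma series_coord u N A : series u N A = series (fun k => u k A) N.
Proof. by rewrite /series /= sum_ffunE. Qed.

Lemma is_cvg_clifford u :
  (forall A, cvgn (fun k => u k A)) -> cvgn u.
Proof.
move=> cu; pose l : clifford R n := [ffun A => limn (fun k => u k A)].
by apply: (cvgP l); apply: cvg_clifford => A; rewrite ffunE; exact: cu.
Qed.

(** Comparison test: each of the finitely many real coordinate series converges absolutely. *)
Lemma clifford_normed_cvg u (v : nat -> R) :
  (forall k A, `|u k A| <= v k) -> cvgn (series v) -> cvgn (series u).
Proof.
move=> uv cv; apply: is_cvg_clifford => A.
under eq_fun do rewrite series_coord.
apply: normed_cvg; apply: series_le_cvg cv => [k|k|k]; first exact: normr_ge0.
  exact: le_trans (uv k A).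
exact: uv.
Qed.

Lemma cvg_clconj u l : u @ \oo --> l -> clconj (u k) @[k --> \oo] --> clconj l.
Proof.
move=> ul; apply: cvg_clifford => A; rewrite ffunE.
under eq_fun do rewrite ffunE.
by apply: cvgMl_tmp; exact: cvg_coord.
Qed.

End CliffordLimits.

(** * The Hardy space: pointwise estimate, coefficients and kernel *)

Section Hardy.
Variables (R : realType) (n : nat).
Hypothesis n_gt0 : (0 < n)%N.
Implicit Types (x y : 'rV[R]_n.+1) (f : 'rV[R]_n.+1 -> clifford R n).
Implicit Types (alpha beta : nat -> clifford R n).

Lemma cvg_series_ball x : unit_ball x ->
  series (fun k => `|para x| ^+ (2 * k)) @ \oo --> 1 / (1 - `|para x| ^+ 2).
Proof.
rewrite /unit_ball /= => x1.
have -> : series (fun k => `|para x| ^+ (2 * k)) = series (geometric 1 (`|para x| ^+ 2)).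
  by congr series; apply/funext => k; rewrite /= mul1r exprM.
by apply: cvg_geometric_series; rewrite ger0_norm ?exprn_ge0 // expr_lt1.
Qed.

(** Cauchy-Schwarz bounds every partial sum uniformly, since partial sums of nonnegative series stay
    below their limits; the bound passes to [f x]. *)
Lemma norm_appell_expansion f alpha x : appell_expansion f alpha -> unit_ball x ->
  `|f x| <= Num.sqrt (limn (series (fun k => `|para x| ^+ (2 * k)))) *
            Num.sqrt (limn (series (fun k => `|alpha k| ^+ 2))).
Proof.
move=> [ca fa] x1; pose s := series (fun k => appell k x * alpha k).
have cf : `|s N| @[N --> \oo] --> `|f x| by apply: cvg_norm; exact: fa.
rewrite -(cvg_lim _ cf) //; apply: limr_le; first exact: cvgP cf.
apply: nearW => N.
set X := limn _; set S := limn _.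
have le_lim (u : nat -> R) : (forall k, 0 <= u k) -> cvgn (series u) ->
    0 <= series u N <= limn (series u).
  move=> u0 cu; rewrite nondecreasing_cvgn_le // ?andbT ?sumr_ge0 //.
  by apply: nondecreasing_series => i _ _; exact: u0.
have /andP[X0 XN] : 0 <= series (fun k => `|para x| ^+ (2 * k)) N <= X.
  by apply: le_lim => [k|]; rewrite ?exprn_ge0 //; exact: cvgP (cvg_series_ball x1).
have /andP[S0 SN] : 0 <= series (fun k => `|alpha k| ^+ 2) N <= S.
  by apply: le_lim => // k; rewrite exprn_ge0.
rewrite -sqrtrM ?(le_trans X0) //.
apply: (@le_trans _ _ (\sum_(0 <= k < N) `|para x| ^+ k * `|alpha k|)).
  rewrite /series /= (le_trans (ler_norm_sum _ _ _)) //.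
  by apply: ler_sum => k _; exact: norm_appellM.
have P0 : 0 <= \sum_(0 <= k < N) `|para x| ^+ k * `|alpha k|.
  by apply: sumr_ge0 => k _; rewrite mulr_ge0 ?exprn_ge0.
rewrite -[leLHS](ger0_norm P0) -sqrtr_sqr ler_wsqrtr //.
apply: le_trans (sum_CauchySchwarz _ _ _) _; apply: ler_pM => //.
- by apply: sumr_ge0 => k _; exact: sqr_ge0.
- by under eq_bigr do rewrite -exprM mulnC.
Qed.

Lemma appell_expansion_uniq f alpha beta :
  appell_expansion f alpha -> appell_expansion f beta -> alpha = beta.
Proof.
move=> [ca fa] [cb fb].
(* Square-summable coefficients are bounded, as [power_series_eq0] requires. *)
have bound (u : nat -> clifford R n) : cvgn (series (fun k => `|u k| ^+ 2)) ->
    forall k, `|u k| <= Num.sqrt (limn (series (fun k => `|u k| ^+ 2))).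
  move=> cu k; rewrite -[leLHS]normr_id -sqrtr_sqr.
  by apply: ler_wsqrtr; apply: (@term_le_series_lim _ (fun i => `|u i| ^+ 2)) => // i; rewrite exprn_ge0.
apply/funext => k; apply/eqP; rewrite -subr_eq0; apply/eqP; move: k.
apply: (@power_series_eq0 _ _ (fun k => alpha k - beta k)) => [k|t /andP[t0 t1]].
  exact: le_trans (ler_normB _ _) (lerD (bound _ ca k) (bound _ cb k)).
have tb : unit_ball (real_point n t).
  by rewrite /unit_ball /= norm_real_point ger0_norm // ltW.
(* At a real point the difference of the two expansions is a power series in t with sum 0. *)
rewrite -[X in _ --> X](subrr (f (real_point n t))).
rewrite [X in X @ _](_ : _ = series (fun k => appell k (real_point n t) * alpha k) -
  series (fun k => appell k (real_point n t) * beta k)).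
  by apply: cvgB; [exact: fa | exact: fb].
apply/funext => N; rewrite fctE. rewrite /series /= -sumrB; apply: eq_bigr => k _.
by rewrite !appell_real_point // -!scalerAl !mul1r -scalerBr.
Qed.

Lemma hardy_coefP f : hardy f -> appell_expansion f (hardy_coef f).
Proof. by move=> [alpha fa]; exact: (xgetPex _ (ex_intro _ alpha fa)). Qed.

(** By uniqueness, any known expansion replaces the one picked by choice. *)
Lemma hardy_coefE f alpha : appell_expansion f alpha -> hardy_coef f = alpha.
Proof.
move=> fa; have hf : hardy f by exists alpha.
exact: appell_expansion_uniq (hardy_coefP hf) fa.
Qed.

(** The scalar part is a coordinate, so it commutes with the limit of the inner product series once
    that series converges; on each term it gives |a_k|^2. *)
Lemma hardy_normE f : hardy f -> hardy_norm f =
  Num.sqrt (limn (series (fun k => `|hardy_coef f k| ^+ 2))).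
Proof.
move=> /hardy_coefP[ca _]; rewrite /hardy_norm /hardy_inner; set a := hardy_coef f in ca *.
pose M : R := #|{set 'I_n}|%:R.
have cs : cvgn (series (fun k => clconj (a k) * a k)).
  apply: (@clifford_normed_cvg _ _ _ (fun k => M * `|a k| ^+ 2)) => [k A|].
    by rewrite (le_trans (ler_coord_mul _ _ _)) // clconj_norm -expr2.
  exact: is_cvg_seriesZ ca.
congr Num.sqrt; apply/esym/cvg_lim => //.
rewrite (_ : series _ =
  fun N => series (fun k => clconj (a k) * a k) N finset.set0).
  exact: cvg_coord.
apply/funext => N; rewrite series_coord; congr (series _ N).
by apply/funext => k; rewrite -clre_conjM.
Qed.

Definition appell_kernel x y : clifford R n :=
  limn (series (fun k => appell k x * clconj (appell k y))).

(** The terms are dominated by a geometric series of ratio |x| |y| < 1. *)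
Lemma is_cvg_appell_kernel x y : unit_ball x -> unit_ball y ->
  cvgn (series (fun k => appell k x * clconj (appell k y))).
Proof.
rewrite /unit_ball /= => x1 y1.
apply: (@clifford_normed_cvg _ _ _ (geometric 1 (`|para x| * `|para y|))) => [k A|].
  rewrite (le_trans (ler_coord_norm _ _)) // (le_trans (norm_appellM _ _ _ n_gt0)) //.
  rewrite clconj_norm /= mul1r exprMn ler_wpM2l ?exprn_ge0 //.
  exact: norm_appell.
apply: is_cvg_geometric_series; rewrite ger0_norm ?mulr_ge0 //.
by rewrite mulr_ilt1.
Qed.

(** Conjugation is continuous and reverses products, which exchanges the two arguments. *)
Lemma appell_kernelC x y : unit_ball x -> unit_ball y ->
  clconj (appell_kernel x y) = appell_kernel y x.
Proof.
move=> x1 y1; apply/esym/cvg_lim => //.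
rewrite (_ : series _ =
  fun N => clconj (series (fun k => appell k x * clconj (appell k y)) N)).
  exact: cvg_clconj (is_cvg_appell_kernel x1 y1).
apply/funext => N; rewrite /series /= clconj_sum; apply: eq_bigr => k _.
by rewrite clconjM clconjK.
Qed.

(** Square summability comes from |P_k(y)|^2 <= |y|^(2k). *)
Lemma appell_kernel_expansion y : unit_ball y ->
  appell_expansion (appell_kernel ^~ y) (fun k => clconj (appell k y)).
Proof.
move=> y1; split; last by move=> x x1; exact: is_cvg_appell_kernel.
apply: series_le_cvg (cvgP _ (cvg_series_ball y1)) => [k|k|k]; rewrite ?exprn_ge0 //.
by rewrite clconj_norm mulnC exprM lerXn2r ?nnegrE ?exprn_ge0 // norm_appell.
Qed.

Lemma appell_kernel_reproducing : reproducing_kernel appell_kernel.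
Proof.
move=> y y1; have Ky := appell_kernel_expansion y1.
split=> [|f /hardy_coefP[_ fa]]; first by exists (fun k => clconj (appell k y)).
rewrite /hardy_inner (hardy_coefE Ky); apply: cvg_lim => //.
by under eq_fun do rewrite clconjK; exact: fa.
Qed.

(* With K_H the Appell kernel, K(x, y) = <K_H(., x), K(., y)> is the conjugate
   of <K(., y), K_H(., x)> = K_H(y, x). *)
Lemma reproducing_kernel_uniq K : reproducing_kernel K ->
  forall x y, unit_ball x -> unit_ball y -> K x y = appell_kernel x y.
Proof.
move=> rK x y x1 y1; have [hK innK] := rK y y1.
have Kx := appell_kernel_expansion x1.
have hKx : hardy (appell_kernel ^~ x) by exists (fun k => clconj (appell k x)).
rewrite -appell_kernelC // -(innK _ hKx).
rewrite /hardy_inner (hardy_coefE Kx).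
(* The expansion of K(., y) at x is conjugated term by term; this is the series of the inner product
   with K_H(., x). *)
have [_ /(_ x x1)/cvg_clconj cK] := hardy_coefP hK.
rewrite -[LHS]clconjK; congr clconj; apply/esym/cvg_lim => //.
rewrite (_ : series _ =
  fun N => clconj (series (fun k => appell k x * hardy_coef (K ^~ y) k) N)).
  exact: cK.
apply/funext => N; rewrite /series /= clconj_sum; apply: eq_bigr => k _.
by rewrite clconjM.
Qed.

End Hardy.

Theorem theorem6p3 (R : realType) (n : nat) (hn : odd n) :
  (forall (f : 'rV[R]_n.+1 -> clifford R n) (x : 'rV[R]_n.+1),
    hardy f -> unit_ball x ->
    `|f x| <= Num.sqrt (limn (series (fun k => `|para x| ^+ (2 * k))))
                * hardy_norm f
    /\ Num.sqrt (limn (series (fun k => `|para x| ^+ (2 * k)))) * hardy_norm f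
       = Num.sqrt (1 / (1 - `|para x| ^+ 2)) * hardy_norm f)
  /\
  (forall x y : 'rV[R]_n.+1, unit_ball x -> unit_ball y ->
    cvgn (series (fun k => appell k x * clconj (appell k y))))
  /\
  reproducing_kernel (fun x y : 'rV[R]_n.+1 =>
    limn (series (fun k => appell k x * clconj (appell k y))))
  /\
  (forall K : 'rV[R]_n.+1 -> 'rV[R]_n.+1 -> clifford R n,
    reproducing_kernel K ->
    forall x y : 'rV[R]_n.+1, unit_ball x -> unit_ball y ->
    K x y = limn (series (fun k => appell k x * clconj (appell k y)))).
Proof.
have n_gt0 := odd_gt0 hn.
split=> [f x hf x1|].
  have xs := cvg_lim (@Rhausdorff R) (cvg_series_ball x1).
  split; last by rewrite xs.
  by rewrite hardy_normE //; apply: norm_appell_expansion => //; exact: hardy_coefP.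
split; first by move=> x y; exact: is_cvg_appell_kernel.
split; first exact: appell_kernel_reproducing.
exact: reproducing_kernel_uniq.
Qed.
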